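(* Consider the online selection problem with $C\ge 1$ units and buyers' valuations in $[L,U]$, $0<L\le U$, and let $\theta=U/L$ and $\alpha=1+\ln\theta$. Let $\psi:[0,1]\to[L,U]$ be $$\psi(x)=\begin{cases} L, & x\in[0,1/\alpha),\\ L\exp(\alpha x-1), & x\in[1/\alpha,1].\end{cases}$$ Then the randomized static pricing algorithm with inverse CDF $\psi$ achieves competitive ratio $\alpha=1+\ln\theta$ (for social welfare) on the online selection problem; that is, for every instance $I$, $\mathrm{OPT}(I)\le \alpha\cdot\mathbb{E}[\mathrm{ALG}(I)]$.
   Context: Online selection problem: a seller has $C$ identical units of an item. Buyers $n=1,\dots,N$ arrive one at a time; buyer $n$ has a private valuation $v_n\in[L,U]$. The number $N$ and the future valuations are unknown to the seller. An instance is $I=(v_1,\dots,v_N)$. On arrival of buyer $n$ a price $p_n$ is posted; buyer $n$ buys one unit ($x_n=1$) if $v_n\ge p_n$ and fewer than $C$ units have been sold so far, otherwise $x_n=0$. The social welfare (seller's revenue plus buyers' utilities) is $\sum_n v_nx_n$. $\mathrm{OPT}(I)=\max\{\sum_n v_nx_n:\ \sum_n x_n\le C,\ x_n\in\{0,1\}\}$ is the sum of the $\min\{C,N\}$ largest valuations. $\mathrm{ALG}(I)$ is the social welfare of the algorithm on $I$, and the competitive ratio of an algorithm is $\sup_I \mathrm{OPT}(I)/\mathbb{E}[\mathrm{ALG}(I)]$, with expectation over the algorithm's internal randomness. Static pricing algorithm with inverse CDF $\psi$: before any arrival, draw $x$ uniformly from $[0,1]$; then post the same price $p=\psi(x)$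 to all buyers, selling one unit to each buyer with $v_n\ge p$ as long as units remain. *)

(* Defs.v *)
From HB Require Import structures.
From mathcomp Require Import all_boot all_order all_algebra.
From mathcomp Require Import all_classical all_reals all_analysis.

Set Implicit Arguments.
Unset Strict Implicit.
Unset Printing Implicit Defensive.

Import Order.TTheory GRing.Theory Num.Theory.

Local Open Scope ring_scope.

(* An instance (v_1, ..., v_N) is a sequence of any finite length N; buyer
   n + 1 has valuation I`_n. *)
Definition valid_instance (R : realType) (L U : R) (I : seq R) : Prop :=
  {in I, forall v, L <= v <= U}.

Definition welfare (R : realType) (I : seq R) (x : seq bool) : R :=
  \sum_(n < size I) I`_n * (nth false x n)%:R.

(* The allocation x = 0 has welfare 0 and is always feasible, so the initial
   value 0 does not affect the maximum. *)
Definition OPT (R : realType) (C : nat) (I : seq R) : R :=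
  \big[Num.max/0]_(x : (size I).-tuple bool | (\sum_(b <- x) b <= C)%N)
     welfare I x.

(* k is the number of units still available. *)
Fixpoint static_sales (R : realType) (p : R) (k : nat) (I : seq R) : seq bool :=
  if I is v :: I' then
    let buys := (p <= v) && (0 < k)%N in
    buys :: static_sales p (k - buys) I'
  else [::].

Definition ALG_static (R : realType) (C : nat) (p : R) (I : seq R) : R :=
  welfare I (static_sales p C I).

(* The seed is drawn from the uniform law on [0, 1], seen as a probability on
   R; only the values of psi on [0, 1] matter. *)
Definition expected_ALG (R : realType) (C : nat) (psi : R -> R) (I : seq R)
    : \bar R :=
  expectation (uniform_prob (@ltr01 R)) (fun x => ALG_static C (psi x) I).

(* Division is that of \bar R: a / 0 = +oo for a > 0, and 0 / 0 = 0 (which is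
   only relevant to the empty instance when 0 < L). *)
Definition competitive_ratio (R : realType) (C : nat) (L U : R) (psi : R -> R)
    : \bar R :=
  ereal_sup [set ((OPT C I)%:E / expected_ALG C psi I)%E
            | I in [set I | valid_instance L U I]]%classic.

Definition alpha (R : realType) (L U : R) : R := 1 + ln (U / L).

Definition psi_static (R : realType) (L U : R) (x : R) : R :=
  if x < (alpha L U)^-1 then L else L * expR (alpha L U * x - 1).

(* Main.v *)
Require Import Defs.
From mathcomp Require Import all_boot all_order all_algebra.
From mathcomp Require Import ring measurable_realfun.
From mathcomp Require Import all_classical all_reals all_analysis.

(** With a price p and k units, at least min(k, #{n | v_n >= p}) units are sold,
each to a buyer of value at least p. Hence the welfare at price p is at least
the sum over the buyers n of any feasible allocation of p * [p <= v_n], and it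
suffices to compare buyer by buyer: psi is chosen so that, for every w in
[L, U], E[psi(X) * [psi(X) <= w]] = w / alpha. The single-buyer instance (L)
shows that the ratio alpha is attained, since there the price is accepted
exactly when it equals L. *)

Set Implicit Arguments.
Unset Strict Implicit.
Unset Printing Implicit Defensive.

Import Order.TTheory GRing.Theory Num.Theory.
Import numFieldNormedType.Exports.
Local Open Scope ring_scope.

Lemma welfare_cons (R : realType) (v : R) (I : seq R) (b : bool) (x : seq bool) :
  welfare (v :: I) (b :: x) = v * b%:R + welfare I x.
Proof. by rewrite /welfare /= big_ord_recl. Qed.

Lemma ALG_static_cons (R : realType) (k : nat) (p v : R) (I : seq R) :
  ALG_static k p (v :: I) =
  if (p <= v) && (0 < k)%N then v + ALG_static k.-1 p I else ALG_static k p I.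
Proof.
rewrite /ALG_static /= welfare_cons; case: ifP => _.
  by rewrite mulr1 subn1.
by rewrite mulr0 add0r subn0.
Qed.

(** Induction over the buyers, with [k] general: a sale adds [v >= p] to the welfare and lowers both
    arguments of the minimum by one. Once [k] is 0, the minimum stays 0. *)
Lemma ALG_static_ge (R : realType) (k : nat) (p : R) (I : seq R) :
  p * (minn k (count (>= p) I))%:R <= ALG_static k p I.
Proof.
elim: I k => [|v I IH] k; first by rewrite /= minn0 mulr0 /ALG_static /welfare big_ord0.
rewrite ALG_static_cons /=; have [pv|pv] /= := boolP (p <= v); last exact: IH.
case: k => [|k] /=; first by have := IH 0%N; rewrite !min0n.
by rewrite add1n minnSS -natr1 mulrDr mulr1 addrC lerD.
Qed.

Lemma ALG_static_ge0 (R : realType) (k : nat) (p : R) (I : seq R) :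
  0 <= p -> 0 <= ALG_static k p I.
Proof. by move=> p0; apply: le_trans _ (ALG_static_ge k p I); rewrite mulr_ge0. Qed.

(** Each summand is a product of two indicators, so it is at most either of them. For a feasible [x]
    the first bound is at most [C], which makes the left side comparable with [ALG_static_ge]. *)
Lemma sum_allocated_ge (R : realType) (p : R) (I : seq R)
    (x : (size I).-tuple bool) :
  (\sum_(n < size I) nth false x n * (p <= I`_n)%R
     <= minn (\sum_(b <- x) b) (count (>= p) I))%N.
Proof.
rewrite leq_min; apply/andP; split.
  rewrite (big_nth false) big_mkord size_tuple leq_sum// => i _.
  by case: (nth _ _ _); case: (_ <= _).
rewrite -sum1_count (big_nth 0) big_mkord [leqRHS]big_mkcond/= leq_sum// => i _.
by case: (nth _ _ _); case: (_ <= _).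
Qed.

Lemma expected_ALGE (R : realType) (k : nat) (psi : R -> R) (I : seq R) :
  expected_ALG k psi I =
  (\int[uniform_prob (@ltr01 R)]_x (ALG_static k (psi x) I)%:E)%E.
Proof. by rewrite /expected_ALG unlock. Qed.

Lemma measurable_ALG_static (R : realType) (k : nat) (I : seq R) :
  measurable_fun [set: R] (fun p => ALG_static k p I).
Proof.
elim: I k => [|v I IH] k.
  by under eq_fun do rewrite /ALG_static /welfare big_ord0; exact: measurable_cst.
under eq_fun do rewrite ALG_static_cons.
apply: measurable_fun_ifT; last exact: IH.
  by apply: measurable_and => //; exact: measurable_fun_ler.
by apply: measurable_funD => //; exact: IH.
Qed.

Section psi_static.
Context (R : realType) (L U : R) (hL : 0 < L) (hLU : L <= U).
Let a := alpha L U.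
Let psi := psi_static L U.

Lemma alpha_ge1 : 1 <= a.
Proof. by rewrite /a /alpha lerDl ln_ge0// ler_pdivlMr// mul1r. Qed.

Let a_gt0 : 0 < a. Proof. exact: lt_le_trans ltr01 alpha_ge1. Qed.

Lemma psi_static_ge (x : R) : L <= psi x.
Proof.
rewrite /psi /psi_static -/a; case: ltP => // ax.
by rewrite ler_peMr ?(ltW hL)// -[leLHS]expR0 ler_expR subr_ge0 -ler_pdivrMl// mulr1.
Qed.

(** The right-hand threshold is the CDF of the price at [w]. On the flat piece both sides are true,
    the threshold being at least [1 / a]; on the other piece, take logarithms. *)
Lemma psi_static_le (w x : R) : L <= w ->
  (psi x <= w) = (x <= (1 + ln (w / L)) / a).
Proof.
move=> Lw; have w0 := lt_le_trans hL Lw.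
have lnw : 0 <= ln (w / L) by rewrite ln_ge0// ler_pdivlMr// mul1r.
rewrite /psi /psi_static -/a; case: ltP => ax.
  rewrite Lw; apply/esym; apply: le_trans (ltW ax) _.
  by rewrite -[leLHS]mul1r ler_pM2r ?invr_gt0// lerDl.
rewrite mulrC -ler_pdivlMr// -[in LHS](@lnK _ (w / L)) ?posrE ?divr_gt0//.
by rewrite ler_expR lerBlDl ler_pdivlMr// mulrC.
Qed.

Lemma measurable_psi_static : measurable_fun [set: R] psi.
Proof.
apply: measurable_fun_ifT => //; first exact: measurable_fun_ltr.
apply: measurable_funM => //; apply: measurableT_comp => //.
by apply: measurable_funB => //; exact: measurable_funM.
Qed.

Lemma measurable_psi_static_below (w : R) :
  measurable_fun [set: R] (fun x => if psi x <= w then psi x else 0).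
Proof.
apply: measurable_fun_ifT => //; last exact: measurable_psi_static.
by apply: measurable_fun_ler => //; exact: measurable_psi_static.
Qed.

Lemma integral_scaled_exp (y : R) : a^-1 <= y ->
  (\int[@lebesgue_measure R]_(x in `[a^-1%R, y]) (L * expR (a * x - 1))%:E
   = (L * expR (a * y - 1) / a - L / a)%:E)%E.
Proof.
(* The fundamental theorem of calculus is applied on a nondegenerate interval; for [y = a^-1] both
   sides are 0. *)
rewrite le_eqVlt => /predU1P[<-|ay].
  by rewrite set_itv1 integral_set1 divff ?gt_eqF// subrr expR0 mulr1 subrr.
have dF (x : R) : is_derive x 1 (fun x => L * expR (a * x - 1) / a)
    (L * expR (a * x - 1)).
  apply: is_derive_eq.
  by rewrite /GRing.scale/= !mulr0 !mulr1 subr0; field; rewrite gt_eqF.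
have dF1 x := @ex_derive _ _ _ _ _ _ _ (dF x).
have cF : continuous (fun x : R => L * expR (a * x - 1) / a).
  by move=> x; exact/differentiable_continuous/derivable1_diffP/dF1.
have cf : continuous (fun x : R => L * expR (a * x - 1)).
  by move=> x; apply/differentiable_continuous/derivable1_diffP; exact: ex_derive.
rewrite (@continuous_FTC2 _ _ (fun x => L * expR (a * x - 1) / a))//.
- by rewrite divff ?gt_eqF// subrr expR0 mulr1.
- exact: continuous_subspaceT.
- split=> [x _||]; first exact: dF1.
    exact/cvg_at_right_filter/cF.
  exact/cvg_at_left_filter/cF.
- by move=> x _; rewrite derive1E; exact: (@derive_val _ _ _ _ _ _ _ (dF x)).
Qed.

(** By [psi_static_le] the integral runs over the seeds up to [y]. The flat piece gives [L / a]; the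
    exponential piece gives [w / a - L / a], since [a * y - 1 = ln (w / L)]. *)
Lemma integral_psi_static_below (w : R) : L <= w <= U ->
  (\int[uniform_prob (@ltr01 R)]_x (if psi x <= w then psi x else 0)%:E = (w / a)%:E)%E.
Proof.
move=> /andP[Lw wU]; have w0 := lt_le_trans hL Lw.
pose y := (1 + ln (w / L)) / a.
have ay : a^-1 <= y.
  by rewrite -[leLHS]mul1r ler_pM2r ?invr_gt0// lerDl ln_ge0// ler_pdivlMr// mul1r.
(* The choice of [alpha] enters here: [1 + ln (w / L) <= a] for all [w <= U], with equality at [U],
   so every seed of the exponential piece up to [y] lies in the unit interval. *)
have y1 : y <= 1.
  rewrite ler_pdivrMr// mul1r lerD2l ler_ln ?posrE ?divr_gt0//.
    by rewrite ler_pM2r ?invr_gt0.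
  exact: lt_le_trans hL hLU.
rewrite integral_uniform; first last.
- move=> x; rewrite lee_fin; case: ifP => // _.
  by rewrite (le_trans (ltW hL))// psi_static_ge.
- by apply/measurable_EFinP; exact: measurable_psi_static_below.
rewrite subr0 invr1 mul1e.
transitivity (\int[@lebesgue_measure R]_(x in `[0%R, 1%R] `&` `]-oo, y]) (psi x)%:E)%E.
  rewrite integral_mkcondr; apply: eq_integral => x _.
  rewrite patchE mem_setE in_itv/= psi_static_le// -/y.
  by case: ifP.
have -> : (`[0%R, 1%R] `&` `]-oo, y] = `[0%R, a^-1[ `|` `[a^-1, y])%classic.
  apply/seteqP; split=> x /=; rewrite !in_itv/=.
    by move=> [/andP[-> _] ->]; case: (ltP x a^-1); [left|right].
  case=> /andP[x0 xa]; first by rewrite x0 !(le_trans (ltW xa))// (le_trans ay).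
  by rewrite (le_trans _ x0) ?invr_ge0 ?(ltW a_gt0)// xa (le_trans xa).
rewrite ge0_integral_setU//=; first last.
- apply/disj_setPLR => x /=; rewrite !in_itv/= => /andP[_ xa].
  by rewrite leNgt xa.
- by move=> x _; rewrite lee_fin (le_trans (ltW hL))// psi_static_ge.
- by apply/measurable_funTS/measurable_EFinP; exact: measurable_psi_static.
rewrite (eq_integral (cst L%:E)); last first.
  by move=> x; rewrite inE/= in_itv/= /psi /psi_static -/a => /andP[_ ->].
rewrite integral_cst//= lebesgue_measure_itv/= lte_fin invr_gt0 a_gt0 oppr0 adde0.
under eq_integral => x.
  rewrite inE/= in_itv/= /psi /psi_static -/a => /andP[ax _]; rewrite ltNge ax/=.
  over.
rewrite integral_scaled_exp// -EFinM -EFinD; congr EFin.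
have -> : a * y = 1 + ln (w / L) by rewrite /y mulrC divfK ?gt_eqF.
rewrite [1 + _]addrC addrK lnK ?posrE ?divr_gt0//.
by field; rewrite !gt_eqF.
Qed.

End psi_static.

Theorem theorem1 (R : realType) (C : nat) (L U : R)
    (hC : (1 <= C)%N) (hL : 0 < L) (hLU : L <= U) :
  competitive_ratio C L U (psi_static L U) = (alpha L U)%:E /\
  (forall I : seq R, valid_instance L U I ->
    ((OPT C I)%:E <= (alpha L U)%:E * expected_ALG C (psi_static L U) I)%E).
Proof.
have a1 := alpha_ge1 hL hLU; have a0 := lt_le_trans ltr01 a1.
have psi_gt0 x : 0 < psi_static L U x by exact: lt_le_trans hL (psi_static_ge hL hLU x).
have mALG I : measurable_fun [set: R] (fun x => (ALG_static C (psi_static L U x) I)%:E).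
  apply/measurable_EFinP.
  apply: (measurableT_comp (@measurable_ALG_static _ C I)).
  exact: measurable_psi_static.
have E0 I : (0 <= expected_ALG C (psi_static L U) I)%E.
  rewrite expected_ALGE integral_ge0// => x _.
  by rewrite lee_fin ALG_static_ge0// ltW.
have ub I : valid_instance L U I ->
    ((OPT C I)%:E <= (alpha L U)%:E * expected_ALG C (psi_static L U) I)%E.
  move=> hI.
  (* The bound is proved for 0 and for each feasible allocation, so no maximiser has to be
     identified. *)
  rewrite /OPT; apply: (big_ind (fun r : R => (r%:E <= (alpha L U)%:E * _)%E)).
  - by rewrite mule_ge0// lee_fin ltW.
  - by move=> x y; rewrite EFin_max ge_max => -> ->.
  move=> x xC; rewrite -lee_pdivrMl//.
  (* [s] lists the buyers served by [x], and [f n t] is the price at seed [t] if buyer [n] accepts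
     it, else 0; its mean is the valuation divided by [alpha]. *)
  pose s := [seq n : 'I_(size I) <- index_enum _ | nth false x n].
  pose f n t : \bar R :=
    (if psi_static L U t <= I`_n then psi_static L U t else 0)%:E.
  have -> : (((alpha L U)^-1)%:E * (welfare I x)%:E
      = \sum_(n <- s) \int[uniform_prob (@ltr01 R)]_t f n t)%E.
    rewrite big_filter -EFinM /welfare mulr_sumr -sumEFin.
    rewrite [RHS]big_mkcond; apply: eq_bigr => n _.
    case: ifP => _; last by rewrite !mulr0.
    by rewrite mulr1 integral_psi_static_below ?hI ?mem_nth// mulrC.
  (* With the sum inside the integral, it is enough to compare the integrands seed by seed. *)
  rewrite expected_ALGE -ge0_integral_sum//; first last.
  - by move=> n t _; rewrite lee_fin; case: ifP => // _; exact: ltW.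
  - by move=> n; apply/measurable_EFinP; exact: measurable_psi_static_below.
  apply: ge0_le_integral => //.
  - move=> t _; apply: sume_ge0 => n _.
    by rewrite lee_fin; case: ifP => // _; exact: ltW.
  - apply: emeasurable_sum => n; apply/measurable_EFinP.
    exact: measurable_psi_static_below.
  - exact: mALG.
  move=> t _; rewrite /f sumEFin lee_fin; apply: le_trans (ALG_static_ge C _ I).
  apply: (@le_trans _ _ (psi_static L U t *
      (\sum_(n < size I) nth false x n * (psi_static L U t <= I`_n)%R)%:R)).
    rewrite big_filter natr_sum mulr_sumr big_mkcond ler_sum// => n _.
    by case: (nth false x n); case: (_ <= I`_n); rewrite ?mulr0 ?mulr1.
  rewrite ler_pM2l// ler_nat; apply: leq_trans (sum_allocated_ge _ _) _.
  by rewrite leq_min geq_minr (leq_trans (geq_minl _ _)).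
split => //; apply/eqP; rewrite eq_le; apply/andP; split.
  apply: ge_ereal_sup => _ [I hI <-].
  have := ub _ hI; have := E0 I.
  have : 0 <= OPT C I by exact: bigmax_ge_id.
  (* The extreme values of the denominator: [-oo] contradicts nonnegativity, [+oo] makes the
     quotient 0, and 0 forces the optimum to be 0, where 0 / 0 = 0. *)
  case: (expected_ALG C _ I) => [r| |] OPT0; last by rewrite leeNy_eq.
    2: by move=> _ _; rewrite invey mule0 lee_fin ltW.
  rewrite lee_fin => r_ge0; have [->|r_neq0] := eqVneq r 0.
    rewrite mule0 lee_fin => OPT1; have -> : OPT C I = 0.
      by apply/le_anti; rewrite OPT0 OPT1.
    by rewrite mul0e lee_fin ltW.
  by rewrite inver (negPf r_neq0) lee_pdivrMr// lt_def r_neq0.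
apply: le_ereal_sup_tmp.
exists ((OPT C [:: L])%:E / expected_ALG C (psi_static L U) [:: L])%E.
  by exists [:: L] => // v; rewrite inE => /eqP ->; rewrite lexx.
(* No price is below [L], so an accepted price is [L] itself and the welfare is the integrand of
   [integral_psi_static_below] at [w = L]. *)
have -> : expected_ALG C (psi_static L U) [:: L] = (L / alpha L U)%:E.
  rewrite expected_ALGE -(integral_psi_static_below hL hLU) ?lexx//.
  apply: eq_integral => x _; rewrite ALG_static_cons hC andbT.
  rewrite /ALG_static /welfare big_ord0 addr0; case: ifP => // pL.
  by congr EFin; apply/le_anti; rewrite pL psi_static_ge.
rewrite inver gt_eqF ?divr_gt0// lee_pdivlMr ?divr_gt0// -EFinM lee_fin.
rewrite mulrC divfK ?gt_eqF//.
(* Only [L <= OPT C [:: L]] is left; serving the buyer is feasible because [1 <= C]. *)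
rewrite -[leLHS](_ : welfare [:: L] [tuple true] = L); last first.
  by rewrite /welfare big_ord1 mulr1.
by apply: le_bigmax_cond; rewrite big_seq1.
Qed.
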